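(* Consider the linear dynamical network $\dot x=Ax+Bu$ with $A\in\mathbb{R}^{N\times N}$, $B\in\mathbb{R}^{N\times M}$, each column of $B$ having exactly one nonzero entry, and nodes $\mathcal{V}=\{v_1,\dots,v_N\}$. Let $K=[B\ AB\ \cdots\ A^{N-1}B]$, and consider a basis matrix of its column space brought (by elementary column operations and a permutation of the rows, i.e. of the nodes) into the form $$\begin{bmatrix} I_h & 0\\ 0 & R^{22}\\ 0 & R^{32}\end{bmatrix},\qquad (\ast)$$ where $I_h$ is the $h\times h$ identity matrix, $h$ is the maximal number of elements of the canonical basis $\mathcal{N}=\{e_1,\dots,e_N\}$ of $\mathbb{R}^N$ that can be included in a basis of the column space of $K$, and $R^{22}$ is a square full rank matrix of dimension $\mathrm{rank}(K)-h$. Then the set of controllable network nodes $\mathcal{C}$ is obtained by the union of two subsets, $\mathcal{C}^1$ and $\mathcal{C}^2$, where - $\mathcal{C}^1$ is the set of $h$ nodes associated to the first $h$ rows of the matrix $(\ast)$, and is unique; - $\mathcal{C}^2$ is composed of the $\mathrm{rank}(K)-h$ nodes associated to the rows of the block $R^{22}$ of the matrix $(\ast)$ and thus, as the selection of $R^{22}$ is not unique, $\mathcal{C}^2$ is not unique either. The set $\mathcal{P}$ of perturbed nodes is composed of the nodes associated to the components of $\bar x_{N-\mathrm{rank}(K)}$ that become generically different from zero through $$\bar x_{N-\mathrm{rank}(K)}=R^{32}(R^{22})^{-1}\,\bar x_{\mathrm{rank}(K)-h}.$$ As the selection of $R^{32}$ depends on that of $R^{22}$, and as the latter is not unique, $\mathcal{P}$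 is not unique either.
   Context: The scalar $x_i$ (the $i$-th component of $x\in\mathbb{R}^N$) is the state of node $v_i$; $A$ encodes the intrinsic node dynamics and the network edges, and $B$ encodes into which nodes (the drivers) the input signals $u\in\mathbb{R}^M$ are injected. A node is controllable iff its state can be steered from any initial condition to any target value in finite time with a suitable selection of $u$. A set of nodes $\mathcal{S}$ is simultaneously controllable iff, from any initial condition $x(0)\in\mathbb{R}^N$ and for any assignment of target values $(\bar x_i)_{i:v_i\in\mathcal{S}}$, there exist a control $u$ and a finite time at which $x_i=\bar x_i$ for all $i$ with $v_i\in\mathcal{S}$. The set of controllable nodes $\mathcal{C}$ is the maximal (in cardinality) set of nodes that are simultaneously controllable. Given a selection of $\mathcal{C}$, the set $\mathcal{P}$ of perturbed nodes is the set of nodes $v_j$ whose final values $\bar x_j$ are imposed when reaching a target state $\bar x_i$ for all $i$ with $v_i\in\mathcal{C}$; these are the nodes downstream of the drivers that are not in $\mathcal{C}$. The reachable points $\bar x$ are those of the column space of $K$ (the controllable subspace). Row $i$ of $K$ is associated with node $v_i$; this association is preserved by elementary column operations and tracked under row permutations. The matrix $(\ast)$ is built by stacking the first $\mathrm{rank}(K)$ linearly independent columns of $K$, applying elementary column operations and row permutations to obtain $\begin{bmatrix} I_h & 0\\ 0& R\end{bmatrix}$ with $R$ of full column rank, and then, by further elementary column operations and row permutations, splitting $R$ into a square full rank block $R^{22}$ and a remaining block $R^{32}$ with $N-\mathrm{rank}(K)$ rows; there can be multiple ways of building the blocks $R^{22}$ and $R^{32}$, which associate to them different sets of nodes. Consistently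 with the row partition of $(\ast)$, a vector of node states is split as $\bar x=[\bar x_h^T\ \ \bar x_{\mathrm{rank}(K)-h}^T\ \ \bar x_{N-\mathrm{rank}(K)}^T]^T$, the subscripts denoting dimensions.
   Formalization: Non-uniqueness of C^2 and of P is asserted only when h < rank(K); if h = rank(K), the block R^{22} is empty and C^2 and P are empty, hence unique. *)

(* Defs.v *)
From HB Require Import structures.
From mathcomp Require Import all_boot all_order all_algebra.
From mathcomp Require Import all_classical all_reals all_analysis.
Set Implicit Arguments.
Unset Strict Implicit.
Unset Printing Implicit Defensive.
Import Order.TTheory GRing.Theory Num.Theory.
Import numFieldNormedType.Exports.
Local Open Scope classical_set_scope.
Local Open Scope ring_scope.

(** [x] solves x' = A x + B u on [0, T].  The inputs may be discontinuous at
    finitely many times [s]; there the state is only required to be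
    continuous. *)
Definition trajectory (R : realType) (N M : nat) (A : 'M[R]_N)
    (B : 'M[R]_(N, M)) (T : R) (u : R -> 'cV[R]_M) (x : R -> 'cV[R]_N) : Prop :=
  (forall i, {within `[0, T], continuous (fun t => x t i 0)}) /\
  exists s : seq R, forall t : R, 0 < t < T -> t \notin s ->
    (forall k, {for t, continuous (fun t => u t k 0)}) /\
    (forall i, is_derive t 1 (fun t => x t i 0) ((A *m x t + B *m u t) i 0)).

Definition steers (R : realType) (N M : nat) (A : 'M[R]_N) (B : 'M[R]_(N, M))
    (x0 x1 : 'cV[R]_N) : Prop :=
  exists (T : R) (u : R -> 'cV[R]_M) (x : R -> 'cV[R]_N),
    [/\ 0 < T, trajectory A B T u x, x 0 = x0 & x T = x1].

Definition simultaneously_controllable (R : realType) (N M : nat)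
    (A : 'M[R]_N) (B : 'M[R]_(N, M)) (S : {set 'I_N}) : Prop :=
  forall (x0 : 'cV[R]_N) (xbar : 'I_N -> R),
    exists x1, steers A B x0 x1 /\ forall i, i \in S -> x1 i 0 = xbar i.

(** Such a set need not be unique, hence a predicate rather than a function. *)
Definition controllable_nodes (R : realType) (N M : nat)
    (A : 'M[R]_N) (B : 'M[R]_(N, M)) (C : {set 'I_N}) : Prop :=
  simultaneously_controllable A B C /\
  forall S, simultaneously_controllable A B S -> (#|S| <= #|C|)%N.

Definition reachable (R : realType) (N M : nat) (A : 'M[R]_N)
    (B : 'M[R]_(N, M)) (xbar : 'cV[R]_N) : Prop :=
  steers A B 0 xbar.

(** [j], outside [C], has its final value imposed by the final values on [C],
    and is actually downstream of the inputs: some control moves it.  Without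
    the last clause, nodes that no input affects, whose final value is always
    0, would count as perturbed. *)
Definition perturbed (R : realType) (N M : nat) (A : 'M[R]_N)
    (B : 'M[R]_(N, M)) (C : {set 'I_N}) (j : 'I_N) : Prop :=
  [/\ j \notin C,
      forall xbar ybar, reachable A B xbar -> reachable A B ybar ->
        (forall i, i \in C -> xbar i 0 = ybar i 0) -> xbar j 0 = ybar j 0
    & exists2 xbar, reachable A B xbar & xbar j 0 != 0].

Definition controllability_mx (R : realType) (N M : nat) (A : 'M[R]_N)
    (B : 'M[R]_(N, M)) : 'M[R]_(N, \sum_(k < N) M) :=
  \mxrow_(k < N) (A ^+ k *m B).

(** The columns of [V] form a basis of the column space of [K] (transposed,
    since [row_free] and [%MS] are about rows). *)
Definition column_basis (R : fieldType) (m n r : nat) (K : 'M[R]_(m, n))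
    (V : 'M[R]_(m, r)) : bool :=
  row_free V^T && (V^T == K^T)%MS.

Definition canonical_in_basis (R : fieldType) (m n : nat) (K : 'M[R]_(m, n))
    (S : {set 'I_m}) : Prop :=
  exists V : 'M[R]_(m, \rank K), column_basis K V /\
    forall i, i \in S -> exists j, col j V = delta_mx i 0.

Definition max_canonical (R : fieldType) (m n : nat) (K : 'M[R]_(m, n)) : nat :=
  \max_(S : {set 'I_m} | `[< canonical_in_basis K S >]) #|S|.

Definition star_mx (R : fieldType) (h d p : nat) (R22 : 'M[R]_d)
    (R32 : 'M[R]_(p, d)) : 'M[R]_(h + d + p, h + d) :=
  col_mx (block_mx 1%:M 0 0 R22) (row_mx 0 R32).

(** A basis matrix [V] of the column space of [K] whose rows, listed in the
    order [sigma], form [star_mx h R22 R32].  The permutation of the rows is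
    given as a bijection [sigma] from block positions to nodes: row [a] of the
    block matrix is associated with node [sigma a]. *)
Definition star_form (R : fieldType) (N n h d p : nat) (K : 'M[R]_(N, n))
    (sigma : 'I_(h + d + p) -> 'I_N) (R22 : 'M[R]_d) (R32 : 'M[R]_(p, d)) :
    Prop :=
  [/\ bijective sigma, R22 \in unitmx
    & exists2 V : 'M[R]_(N, h + d), column_basis K V
        & rowsub sigma V = star_mx h R22 R32].

Definition row1 (h d p : nat) (a : 'I_h) : 'I_(h + d + p) :=
  lshift p (lshift d a).
Definition row2 (h d p : nat) (a : 'I_d) : 'I_(h + d + p) :=
  lshift p (rshift h a).
Definition row3 (h d p : nat) (a : 'I_p) : 'I_(h + d + p) :=
  rshift (h + d) a.

Definition nodes1 (N h d p : nat) (sigma : 'I_(h + d + p) -> 'I_N) :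
    {set 'I_N} := [set sigma (row1 d p a) | a : 'I_h].
Definition nodes2 (N h d p : nat) (sigma : 'I_(h + d + p) -> 'I_N) :
    {set 'I_N} := [set sigma (row2 h p a) | a : 'I_d].

Definition state2 (R : fieldType) (N h d p : nat)
    (sigma : 'I_(h + d + p) -> 'I_N) (xbar : 'cV[R]_N) : 'cV[R]_d :=
  rowsub (fun a => sigma (row2 h p a)) xbar.
Definition state3 (R : fieldType) (N h d p : nat)
    (sigma : 'I_(h + d + p) -> 'I_N) (xbar : 'cV[R]_N) : 'cV[R]_p :=
  rowsub (fun a => sigma (row3 h d a)) xbar.

(** Genericity in the topological sense; for the linear conditions
    [f v != 0] it is used with, it agrees with the Zariski and
    almost-everywhere ones. *)
Definition generically (R : realType) (n : nat) (P : 'cV[R]_n -> Prop) : Prop :=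
  exists U : set 'cV[R]_n, [/\ open U, dense U & forall v, U v -> P v].

Definition nodes3_nonzero (R : realType) (N h d p : nat)
    (sigma : 'I_(h + d + p) -> 'I_N) (R22 : 'M[R]_d) (R32 : 'M[R]_(p, d)) :
    {set 'I_N} :=
  [set sigma (row3 h d a) | a : 'I_p &
    `[< generically
          (fun v : 'cV[R]_d => (R32 *m invmx R22 *m v) a 0 != 0) >]].

(* Main.v *)
Require Import Defs.
From HB Require Import structures.
From mathcomp Require Import all_boot all_order all_algebra.
From mathcomp Require Import all_classical all_reals all_analysis.
From mathcomp Require Import ring lra.
Set Implicit Arguments.
Unset Strict Implicit.
Unset Printing Implicit Defensive.
Import Order.TTheory GRing.Theory Num.Theory.
Import numFieldNormedType.Exports.
Local Open Scope ring_scope.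

(** The space reachable from 0 is the column space W of the controllability
    matrix K, and from any initial state one can reach, at some time, a
    translate of W.  Hence a set C of nodes is simultaneously controllable
    exactly when the coordinates in C take arbitrary values on W
    ([assignable]), that is when the rows of K indexed by C are independent.
    The largest such sets are those of cardinality rank K, and on such a set W
    is the graph of a linear map from the coordinates in C to the other ones.

    Reachable states lie in W ([reachable_span]): for L spanning the left
    kernel of K, Cayley-Hamilton gives L A = F L for some F, and L B = 0, so
    that z = L x solves z' = F z along any trajectory, whatever the input.  As
    z starts from 0 and exp(-ct)|z|^2 is nonincreasing for large c
    ([linear_ode_zero]), z stays at 0.  The finitely many times at which the
    input jumps are harmless because z is continuous there.

    Conversely every point of W is reached ([moves_span]), by polynomial inputs
    rather than through the Gramian.  If A^N is the sum of the c_j A^j, the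
    combination of the A^j b whose coefficients are obtained from a polynomial
    beta by iterating g -> g' - c_j beta satisfies x' = A x + p b for some
    polynomial p ([poly_motion]).  Taking for beta a power of X times a power
    of X - 1 prescribes which coefficients vanish at the times 0 and 1, and
    A^k b is reached modulo lower powers of A ([moves_exp]).  Adding the free
    motion, a power series ([free_motion]), gives other initial states.

    The rest is linear algebra in W.  The canonical vectors that can enter a
    basis of W are those that belong to W; let E be their set of indices.  If
    C is a largest assignable set, then E is included in C, as otherwise a
    vector of E could be used to enlarge C.  The basis of W that is dual to
    the coordinates in C automatically contains the vectors of E
    ([reduced_basis_canonical]) and so, with the nodes ordered as E, C minus
    E, the other ones, has the required block form with identity blocks.  In
    any block form the first nodes are in E, hence are all of E by counting,
    which is the uniqueness of C^1.  A node outside C is perturbed exactly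
    when its coordinate is not identically zero on W.  Finally, for i in C but
    not in E, the dual vector of i is not e_i, hence has a nonzero coordinate
    at some node j outside C; exchanging i and j ([assignable_exchange]) yields another
    largest set, for which j belongs to C^2 and is no longer perturbed, while
    i leaves C^2. *)

(** * Uniqueness for linear differential equations *)

Section Ode.
Local Open Scope classical_set_scope.
Local Open Scope ring_scope.

(** An exceptional point cuts the interval in two, and neither open half
    contains it; continuity at the point glues the two inequalities. *)
Lemma nincr_finite_exceptions (R : realType) (f : R -> R) (s : seq R) (a b : R) :
  a <= b -> {within `[a, b], continuous f} ->
  (forall t, a < t < b -> t \notin s ->
     exists2 df, is_derive t 1 f df & df <= 0) ->
  f b <= f a.
Proof.
elim: s a b => [|c s IH] a b ab cf df.
  apply: (@ler0_derive1_le_cc _ f a b) => [x|x|//|||//];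
    rewrite ?in_itv/= ?lexx ?ab// => xab.
    by have [] := df x xab isT.
  have [l dl l0] := df x xab isT.
  by rewrite derive1E derive_val.
case: (boolP (a < c < b)) => [/andP[ac cb]|ncab]; last first.
  apply: IH => // t tab ts; apply: df => //.
  rewrite inE negb_or ts andbT.
  by apply: contraNneq ncab => <-.
have cfW x y : a <= x -> y <= b -> {within `[x, y], continuous f}.
  move=> ax yb; apply: continuous_subspaceW cf => z /=.
  rewrite !in_itv/= => /andP[xz zy].
  by rewrite (le_trans ax xz) (le_trans zy yb).
apply: (@le_trans _ _ (f c)).
  apply: IH; [exact: ltW|by apply: cfW => //; exact: ltW|].
  move=> t /andP[ct tb] ts; apply: df; first by rewrite (lt_trans ac ct) tb.
  by rewrite inE negb_or ts andbT gt_eqF.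
apply: IH; [exact: ltW|by apply: cfW => //; exact: ltW|].
move=> t /andP[ct tb] ts; apply: df; first by rewrite ct (lt_trans tb cb).
by rewrite inE negb_or ts andbT lt_eqF.
Qed.

(** With q = |z|^2, one has q' <= C q for C twice the sum of the |F i j|, so
    exp(-C t) q is nonincreasing; it is nonnegative and starts at 0. *)
Lemma linear_ode_zero (R : realType) (n : nat) (F : 'M[R]_n) (T : R)
    (z : R -> 'cV[R]_n) (s : seq R) :
  0 < T ->
  (forall i, {within `[0, T], continuous (fun t => z t i 0)}) ->
  (forall t, 0 < t < T -> t \notin s ->
     forall i, is_derive t 1 (fun t => z t i 0) ((F *m z t) i 0)) ->
  z 0 = 0 -> z T = 0.
Proof.
move=> T0 cz dz z0.
(* the factor 2 absorbs both squares in 2|z_i||z_j| <= z_i^2 + z_j^2 <= 2q *)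
pose C := 2 * \sum_i \sum_j `|F i j|.
pose q t : R := \sum_i z t i 0 * z t i 0.
pose g t : R := expR (- C * t) * q t.
have q_ge0 t : 0 <= q t by apply: sumr_ge0 => i _; rewrite -expr2 sqr_ge0.
have zq t i : z t i 0 * z t i 0 <= q t.
  rewrite /q (bigD1 i)//= lerDl; apply: sumr_ge0 => j _.
  by rewrite -expr2 sqr_ge0.
have gT : g T <= g 0.
  apply: (@nincr_finite_exceptions _ _ s); first exact: ltW.
    rewrite /g; move=> t.
    apply: cvgM.
      apply: continuous_subspaceT => {}t.
      apply: (@continuous_comp _ _ _ (fun t : R => - C * t) expR).
        exact: mulrl_continuous.
      exact: continuous_expR.
    rewrite /q.
    apply: (@cvg_big _ _ +%R 0 xpredT _ _ (nbhs (t : subspace `[0, T])) _ _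
      (fun i => z t i 0 * z t i 0)) => [|i _]; first exact: add_continuous.
    by apply: cvgM; exact: cz.
  move=> t tT ts.
  have dq : is_derive t 1 q (\sum_i 2 * (z t i 0 * (F *m z t) i 0)).
    rewrite /q -fct_sumE.
    apply: is_derive_sum => i.
    have ? := dz t tT ts i.
    apply: (@is_derive_eq _ _ _ ((fun t => z t i 0) * (fun t => z t i 0))).
    by rewrite /GRing.scale/=; ring.
  have de : is_derive t 1 (fun t => expR (- C * t)) (- C * expR (- C * t)).
    have dl : is_derive t 1 (fun t : R => - C * t) (- C).
      apply: (@is_derive_eq _ _ _ ((- C) \*: id)).
      by rewrite /GRing.scale/= mulr1.
    have := @is_derive1_comp _ expR _ t _ _ (is_derive_expR _) dl.
    by rewrite mulrC.
  exists (expR (- C * t) * (\sum_i 2 * (z t i 0 * (F *m z t) i 0) - C * q t)).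
    apply: (@is_derive_eq _ _ _ ((fun t => expR (- C * t)) * q)).
    by rewrite /GRing.scale/=; ring.
  rewrite pmulr_rle0 ?expR_gt0// subr_le0 /C -mulr_sumr -mulrA ler_pM2l//.
  rewrite mulr_suml; apply: ler_sum => i _.
  rewrite mxE mulr_sumr mulr_suml; apply: ler_sum => j _.
  apply: (le_trans (ler_norm _)).
  rewrite !normrM mulrCA ler_wpM2l//.
  have := zq t i; have := zq t j.
  rewrite -!expr2 -[z t i 0 ^+ 2]real_normK ?num_real// -[z t j 0 ^+ 2]real_normK ?num_real//.
  by have := sqr_ge0 (`|z t i 0| - `|z t j 0|); nra.
have qT : q T = 0.
  apply/eqP; rewrite eq_le q_ge0 andbT.
  have : g T <= 0.
    apply: (le_trans gT); rewrite /g /q z0 big1 ?mulr0// => i _.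
    by rewrite mxE mulr0.
  by rewrite pmulr_rle0 ?expR_gt0.
apply/colP => i; rewrite [RHS]mxE; apply/eqP.
by rewrite -sqrf_eq0 eq_le expr2 -[X in _ <= X]qT zq -expr2 sqr_ge0.
Qed.

End Ode.


(** * Motions on the whole line *)

Section Motion.
Local Open Scope classical_set_scope.
Local Open Scope ring_scope.

(** Cayley-Hamilton, in a form that also covers matrices of size 0. *)
Lemma exp_mx_comb (F : fieldType) (N : nat) (A : 'M[F]_N) :
  exists c : nat -> F, A ^+ N = \sum_(j < N) c j *: A ^+ j.
Proof.
case: N A => [|n] A.
  by exists (fun=> 0); rewrite [LHS]flatmx0 [RHS]flatmx0.
pose p := char_poly A.
exists (fun j => - p`_j).
have := Cayley_Hamilton A.
have sp : size p = n.+2 by rewrite size_char_poly.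
have pn : p`_n.+1 = 1.
  by have /monicP := char_poly_monic A; rewrite lead_coefE -/p sp.
rewrite -/p -[p in horner_mx A p]coefK poly_def sp linear_sum/=.
under eq_bigr do rewrite linearZ/= rmorphXn/= horner_mx_X.
rewrite big_ord_recr/= pn scale1r => /eqP.
rewrite addrC addr_eq0 => /eqP->.
by rewrite -sumrN; apply: eq_bigr => i _; rewrite scaleNr.
Qed.

(** A trajectory defined for all times and without exceptional points; unlike
    [trajectory] it is visibly stable under linear combinations. *)
Definition whole_motion (R : realType) (N M : nat) (A : 'M[R]_N)
    (B : 'M[R]_(N, M)) (u : R -> 'cV[R]_M) (x : R -> 'cV[R]_N) : Prop :=
  forall t,
    (forall k, {for t, continuous (fun t => u t k 0)}) /\
    (forall i, is_derive t 1 (fun t => x t i 0) ((A *m x t + B *m u t) i 0)).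

(** The transfer time is fixed to 1 so that motions can be superposed. *)
Definition moves (R : realType) (N M : nat) (A : 'M[R]_N)
    (B : 'M[R]_(N, M)) (x0 x1 : 'cV[R]_N) : Prop :=
  exists u x, [/\ whole_motion A B u x, x 0 = x0 & x 1 = x1].

Lemma moves_steers (R : realType) (N M : nat) (A : 'M[R]_N)
    (B : 'M[R]_(N, M)) (x0 x1 : 'cV[R]_N) :
  moves A B x0 x1 -> steers A B x0 x1.
Proof.
move=> [u [x [ux x0E x1E]]]; exists 1, u, x; split=> //; split.
  move=> i; apply: derivable_within_continuous => t _.
  by have [_ /(_ i) dx] := ux t; exact: ex_derive.
by exists [::] => t _ _; exact: ux.
Qed.

Lemma moves_lin (R : realType) (N M : nat) (A : 'M[R]_N)
    (B : 'M[R]_(N, M)) (a : R) (x0 x1 y0 y1 : 'cV[R]_N) :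
  moves A B x0 x1 -> moves A B y0 y1 ->
  moves A B (a *: x0 + y0) (a *: x1 + y1).
Proof.
move=> [u [x [ux <- <-]]] [v [y [vy <- <-]]].
exists (fun t => a *: u t + v t), (fun t => a *: x t + y t); split=> // t.
have [cu dx] := ux t; have [cv dy] := vy t; split=> i.
  have -> : (fun t => (a *: u t + v t) i 0)
      = (a \*: (fun t => u t i 0) + (fun t => v t i 0)).
    by apply/funext => s; rewrite !mxE.
  apply: continuousD; last exact: cv.
  apply: continuousZl_tmp; exact: cu.
have -> : (fun t => (a *: x t + y t) i 0)
    = (a \*: (fun t => x t i 0) + (fun t => y t i 0)).
  by apply/funext => s; rewrite !mxE.
have ? := dx i; have ? := dy i.
apply: is_derive_eq.
rewrite !mulmxDr -!scalemxAr !mxE /GRing.scale/=; ring.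
Qed.

(** The Taylor coefficients of the coordinates of exp(tA) y. *)
Definition flow_coef (R : realType) (N : nat) (A : 'M[R]_N) (y : 'cV[R]_N)
  (i : 'I_N) (k : nat) : R := (A ^+ k *m y) i 0 / k`!%:R.

(** Differentiating the power series of exp(tA) y termwise amounts to
    replacing y by A y. *)
Lemma flow_coef_diffs (R : realType) (N : nat) (A : 'M[R]_N) (y : 'cV[R]_N) i :
  pseries_diffs (flow_coef A y i) = flow_coef A (A *m y) i.
Proof.
apply/funext => k; rewrite /pseries_diffs /flow_coef exprSr -mulmxA factS.
by rewrite natrM invfM mulrCA mulVKf.
Qed.

(** The l^1 norm of A^k y is at most C^k times that of y, for C the sum of
    the |A i j|, and the series is dominated by that of exp(C|t|). *)
Lemma flow_coef_cvg (R : realType) (N : nat) (A : 'M[R]_N) (y : 'cV[R]_N) i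
    (t : R) : cvgn (pseries (flow_coef A y i) t).
Proof.
pose C : R := \sum_i \sum_j `|A i j|; pose n1 (v : 'cV[R]_N) : R := \sum_i `|v i 0|.
have C0 : 0 <= C by apply: sumr_ge0 => ? _; apply: sumr_ge0.
have n1_le (v : 'cV[R]_N) j : `|v j 0| <= n1 v.
  by rewrite /n1 (bigD1 j)//= lerDl; apply: sumr_ge0.
have n1A (v : 'cV[R]_N) : n1 (A *m v) <= C * n1 v.
  rewrite /C mulr_suml; apply: ler_sum => j _.
  rewrite mxE mulr_suml (le_trans (ler_norm_sum _ _ _))//.
  by apply: ler_sum => k _; rewrite normrM ler_wpM2l.
have n1X k (v : 'cV[R]_N) : n1 (A ^+ k *m v) <= C ^+ k * n1 v.
  elim: k v => [|k IH] v; first by rewrite !expr0 mul1mx mul1r.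
  rewrite exprSr -mulmxA (le_trans (IH _))// exprSr -mulrA.
  by rewrite ler_wpM2l// exprn_ge0.
apply: normed_cvg.
apply: (@series_le_cvg _ _ (n1 y *: exp_coeff (C * `|t|))).
- by move=> n /=.
- move=> n; apply: mulr_ge0; first exact: sumr_ge0.
  by rewrite exp_coeff_ge0 ?mulr_ge0.
- move=> n; rewrite /= /flow_coef normrM normrM normrX normfV.
  rewrite [`|_%:R|]ger0_norm//.
  have -> : (n1 y *: exp_coeff (C * `|t|)) n
      = C ^+ n * n1 y / n`!%:R * `|t| ^+ n.
    transitivity (n1 y * ((C * `|t|) ^+ n / n`!%:R)); first by [].
    by rewrite exprMn; ring.
  rewrite ler_wpM2r ?exprn_ge0// ler_wpM2r//.
  exact: le_trans (n1_le _ _) (n1X _ _).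
- by apply: is_cvg_seriesZ; exact: is_cvg_series_exp_coeff.
Qed.

(** With zero input, the motion is exp(tA) x0. *)
Lemma free_motion (R : realType) (N M : nat) (A : 'M[R]_N)
    (B : 'M[R]_(N, M)) (x0 : 'cV[R]_N) : exists x1, moves A B x0 x1.
Proof.
pose x t : 'cV[R]_N := \col_i limn (pseries (flow_coef A x0 i) t).
exists (x 1), (fun=> 0), x; split=> //; last first.
  apply/colP => i; rewrite mxE; apply: lim_near_cst => //.
  near=> m; rewrite -[m]prednK; last by near: m.
  rewrite /pseries /series/= big_nat_recl// big1 ?addr0; last first.
    by move=> j _; rewrite expr0n mulr0.
  by rewrite /flow_coef !expr0 mul1mx mulr1 divr1.
move=> t; split=> i.
  have -> : (fun _ : R => (0 : 'cV[R]_M) i 0) = cst 0.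
    by apply/funext => s; rewrite mxE.
  exact: cst_continuous.
have -> : (fun t => x t i 0) = (fun t => limn (pseries (flow_coef A x0 i) t)).
  by apply/funext => s; rewrite mxE.
(* any radius of convergence beyond |t| would do *)
have := @pseries_snd_diffs R (flow_coef A x0 i) (`|t| + 1) t.
rewrite !flow_coef_diffs => H.
suff <- : limn (pseries (flow_coef A (A *m x0) i) t)
    = (A *m x t + B *m 0) i 0.
  apply: H; try exact: flow_coef_cvg.
  by rewrite [ltRHS]ger0_norm ?addr_ge0// ltrDl.
rewrite mulmx0 addr0 mxE; apply: cvg_lim => //.
have -> : pseries (flow_coef A (A *m x0) i) t
    = (fun n => \sum_j A i j * pseries (flow_coef A x0 j) t n).
  apply/funext => n; rewrite /pseries /series/=.
  under [RHS]eq_bigr do rewrite mulr_sumr.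
  rewrite exchange_big/=; apply: eq_bigr => k _.
  rewrite /flow_coef mulmxA -[_ *m A]/(_ * A) -exprSr exprS -mulmxA mxE.
  by rewrite !mulr_suml; apply: eq_bigr => j _; ring.
apply: (@cvg_big _ _ +%R 0); first exact: add_continuous.
by move=> j _; rewrite mxE; apply: cvgMl_tmp; exact: flow_coef_cvg.
Unshelve. all: by end_near. Qed.
End Motion.


(** * The reachable space *)

Section Reach.
Local Open Scope classical_set_scope.
Local Open Scope ring_scope.

(** The successive coefficients of A^(N-1) b, A^(N-2) b, ... along a motion
    whose first coefficient is [beta]; matching the coefficients of the A^j b
    in x' = A x + p b, with A^N expanded on the lower powers, forces this
    recursion, in which [c] lists the coefficients of A^N from the highest
    power down. *)
Fixpoint flat_output (R : nzRingType) (c : nat -> R) (beta : {poly R}) (i : nat) :=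
  if i is i'.+1 then (flat_output c beta i')^`() - c i' *: beta else beta.

(** Each step lowers the multiplicity of a root of [beta] by exactly one: the
    derivative does so, and the subtracted multiple of [beta] still has the
    full multiplicity. *)
Lemma flat_output_root (R : realFieldType) (c : nat -> R) (a : R) (m i : nat)
    (q0 : {poly R}) : q0.[a] != 0 -> (i <= m)%N ->
  exists2 q, flat_output c (('X - a%:P) ^+ m * q0) i = ('X - a%:P) ^+ (m - i) * q
           & q.[a] != 0.
Proof.
move=> q0a; elim: i => [_|i IH im]; first by exists q0; rewrite ?subn0.
have [q /= -> qa] := IH (ltnW im).
have -> : (m - i = (m - i.+1).+1)%N by rewrite subnSK.
set k := (m - i.+1)%N.
exists (k.+1%:R *: q + ('X - a%:P) * q^`() - c i *: (('X - a%:P) ^+ i.+1 * q0)).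
  have -> : ('X - a%:P) ^+ m = ('X - a%:P) ^+ k * ('X - a%:P) ^+ i.+1.
    by rewrite -exprD /k subnK.
  rewrite derivM deriv_exp derivXsubC mul1r /= -mulr_natl -!mul_polyC exprSr.
  by rewrite polyC_natr; ring.
rewrite 2!hornerD hornerN hornerZ [X in _ - X]hornerZ !hornerM horner_exp.
rewrite hornerXsubC subrr exprS !(mul0r, mulr0, subr0, addr0).
by rewrite mulf_neq0// pnatr_eq0.
Qed.

(** Both sides of x' = A x + p b, with p the N-th term of the recursion,
    are the combination of b, A b, ..., A^N b whose coefficients are the
    terms of the recursion in decreasing order. *)
Lemma poly_motion (R : realType) (N M : nat) (A : 'M[R]_N) (B : 'M[R]_(N, M))
    (c : nat -> R) (v : 'cV[R]_M) (beta : {poly R}) :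
  A ^+ N = \sum_(j < N) c j *: A ^+ j ->
  let x t := \sum_(j < N)
    (flat_output (fun i => c (N.-1 - i)%N) beta (N.-1 - j)).[t]
      *: (A ^+ j *m (B *m v)) in
  moves A B (x 0) (x 1).
Proof.
move=> AN; set g := flat_output _ _; move=> x.
exists (fun t => (g N).[t] *: v), x; split=> // t; split=> i.
  have -> : (fun t => ((g N).[t] *: v) i 0) = horner (v i 0 *: g N).
    by apply/funext => s; rewrite !mxE hornerZ mulrC.
  exact: continuous_horner.
pose P := \sum_(j < N) (A ^+ j *m (B *m v)) i 0 *: g (N.-1 - j)%N.
have -> : (fun t => x t i 0) = horner P.
  apply/funext => s; rewrite /x /P summxE horner_sum.
  by apply: eq_bigr => j _; rewrite mxE hornerZ mulrC.
suff -> : A *m x t + B *m ((g N).[t] *: v)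
    = \sum_(j < N) (g (N.-1 - j)%N)^`().[t] *: (A ^+ j *m (B *m v)).
  suff -> : (\sum_(j < N) (g (N.-1 - j)%N)^`().[t] *: (A ^+ j *m (B *m v))) i 0
     = P^`().[t] by exact: is_derive_poly.
  rewrite /P linear_sum horner_sum summxE.
  by apply: eq_bigr => j _; rewrite mxE /= derivZ hornerZ mulrC.
set b := B *m v.
transitivity (\sum_(j < N.+1) (g (N - j)%N).[t] *: (A ^+ j *m b)).
  rewrite big_ord_recl subn0 expr0 mul1mx -scalemxAr addrC; congr (_ + _).
  rewrite /x mulmx_sumr; apply: eq_bigr => j _.
  rewrite -scalemxAr (mulmxA A) -[A *m A ^+ _]/(A * A ^+ _) -exprS; congr (_.[t] *: _).
  by rewrite /= /bump/= add1n subnS predn_sub.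
rewrite big_ord_recr/= subnn AN mulmx_suml scaler_sumr -big_split/=.
apply: eq_bigr => j _.
have -> : (N - j = (N.-1 - j).+1)%N.
  by case: (N) j => [[]//|n] j /=; rewrite subSn// -ltnS.
have -> : g (N.-1 - j).+1 = (g (N.-1 - j)%N)^`() - c j *: beta.
  rewrite /g/=; congr (_ - c _ *: _).
  by rewrite subKn//; case: (N) j => [[]//|n] j; rewrite -ltnS.
rewrite -scalemxAl scalerA -scalerDl; congr (_ *: _).
by rewrite /g /= hornerD hornerN hornerZ mulrC subrK.
Qed.

Lemma moves0 (R : realType) (N M : nat) (A : 'M[R]_N) (B : 'M[R]_(N, M)) :
  moves A B 0 0.
Proof.
have [x1 m1] := free_motion A B 0.
by have := moves_lin (-1) m1 m1; rewrite scaler0 addr0 scaleN1r addNr.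
Qed.

(** For [beta] = X^N (X - 1)^(N-1-k), all the coefficients vanish at time 0,
    and those of the A^j b with j > k vanish at time 1 while that of A^k b does
    not; the powers below k are reached by induction. *)
Lemma moves_exp (R : realType) (N M : nat) (A : 'M[R]_N) (B : 'M[R]_(N, M))
    (v : 'cV[R]_M) (k : nat) :
  (k < N)%N -> moves A B 0 (A ^+ k *m (B *m v)).
Proof.
have [c AN] := exp_mx_comb A; set b := B *m v.
elim/ltn_ind: k => k IH kN.
pose m := (N.-1 - k)%N.
pose beta : {poly R} := ('X - 0%:P) ^+ N * ('X - 1%:P) ^+ m.
have := poly_motion B v beta AN.
set g := flat_output _ beta => /= mv.
have Nm : (N.-1 < N)%N by rewrite prednK// (leq_ltn_trans _ kN).
have g0 i : (i < N)%N -> (g i).[0] = 0.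
  move=> iN; have [||q] := @flat_output_root R (fun i => c (N.-1 - i)%N) 0 N i
    (('X - 1%:P) ^+ m); last first.
  - rewrite -/beta -/g => -> _.
    by rewrite hornerM horner_exp hornerXsubC subrr expr0n subn_eq0 leqNgt iN mul0r.
  - exact: ltnW.
  - by rewrite horner_exp hornerXsubC expf_neq0// sub0r oppr_eq0 oner_eq0.
have g1 i : (i <= m)%N -> exists2 q, g i = ('X - 1%:P) ^+ (m - i) * q & q.[1] != 0.
  move=> im; rewrite /g /beta mulrC; apply: flat_output_root => //.
  by rewrite horner_exp hornerXsubC subr0 expr1n oner_eq0.
have [q gm q1] := g1 m (leqnn m).
have mk : (N.-1 - k)%N = m by [].
have gm1 : (g m).[1] = q.[1] by rewrite gm subnn mul1r.
rewrite big1 in mv; last first.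
  by move=> j _; rewrite g0 ?scale0r// (leq_ltn_trans (leq_subr _ _)).
pose y := \sum_(j < N | (j < k)%N) (g (N.-1 - j)%N).[1] *: (A ^+ j *m b).
have My : moves A B 0 y.
  apply: (big_ind (moves A B 0)) => [|z1 z2 m1 m2|j jk]; first exact: moves0.
    by have := moves_lin 1 m1 m2; rewrite !scale1r addr0.
  have := moves_lin (g (N.-1 - j)%N).[1] (IH j jk (ltn_ord j)) (moves0 A B).
  by rewrite scaler0 !addr0.
(* g (N - 1 - j) still has the root 1 when j > k, so only j <= k survives *)
have xE : \sum_(j < N) (g (N.-1 - j)%N).[1] *: (A ^+ j *m b)
    = q.[1] *: (A ^+ k *m b) + y.
  rewrite (bigID (fun j : 'I_N => (j < k)%N))/= -/y addrC; congr (_ + _).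
  rewrite (bigD1 (Ordinal kN)) ?ltnn//= mk gm1 big1 ?addr0// => j.
  rewrite -leqNgt => /andP[kj jk].
  have {}kj : (k < j)%N by rewrite ltn_neqAle kj andbT eq_sym.
  have jm : (N.-1 - j < m)%N.
    rewrite /m ltn_sub2l//; apply: leq_trans kj _.
    by rewrite -ltnS prednK// (leq_ltn_trans _ kN).
  have [q' -> _] := g1 _ (ltnW jm).
  rewrite hornerM horner_exp hornerXsubC subrr expr0n subn_eq0 leqNgt jm.
  by rewrite mul0r scale0r.
rewrite xE in mv.
have := moves_lin q.[1]^-1 (moves_lin (-1) My mv) (moves0 A B).
rewrite !scaler0 !addr0 scaleN1r (addrC (- y)) addrK scalerA.
by rewrite mulVf// scale1r scaler0.
Qed.

Lemma controllability_mxE (R : realType) (N M : nat) (A : 'M[R]_N) (B : 'M[R]_(N, M))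
    (w : 'cV[R]_(\sum_(k < N) M)) :
  controllability_mx A B *m w = \sum_(k < N) A ^+ k *m (B *m submxcol w k).
Proof.
rewrite -[in LHS](submxcolK w) mul_mxrow_mxcol.
by apply: eq_bigr => k _; rewrite mulmxA.
Qed.

Lemma moves_span (R : realType) (N M : nat) (A : 'M[R]_N) (B : 'M[R]_(N, M))
    (w : 'cV[R]_(\sum_(k < N) M)) :
  moves A B 0 (controllability_mx A B *m w).
Proof.
rewrite controllability_mxE; elim/big_rec: _ => [|k x _ mx].
  exact: moves0.
have := moves_lin 1 (moves_exp A B (submxcol w k) (ltn_ord k)) mx.
by rewrite !scale1r addr0.
Qed.

(** The coordinates of x along the left kernel of K obey an autonomous linear
    equation, since the input does not act on them, and therefore remain
    zero.  Conversely, polynomial inputs reach the whole column space. *)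
Lemma reachable_span (R : realType) (N M : nat) (A : 'M[R]_N) (B : 'M[R]_(N, M))
    (x1 : 'cV[R]_N) :
  reachable A B x1 <-> exists w, x1 = controllability_mx A B *m w.
Proof.
split=> [[T [u [x [T0 [cx [s dx]] x0 <-]]]]|[w ->]]; last first.
  exact/moves_steers/moves_span.
set K := controllability_mx A B; pose L := kermx K.
have LK : forall k, (k < N)%N -> L *m (A ^+ k *m B) = 0.
  move=> k kN; have := mulmx_ker K.
  rewrite {2}/K /controllability_mx mul_mxrow -(mxrow0 (q_ := fun=> M)).
  by move=> /eq_mxrowP/(_ (Ordinal kN)).
have LN : L *m (A ^+ N *m B) = 0.
  have [c ->] := exp_mx_comb A.
  rewrite mulmx_suml mulmx_sumr big1// => j _.
  by rewrite -scalemxAl -scalemxAr LK// scaler0.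
have LB : L *m B = 0.
  case: (posnP N) => [N0|/LK]; last by rewrite expr0 mul1mx.
  by apply/matrixP => -[i iN]; exfalso; rewrite N0 in iN.
have /submxP[F LA] : (L *m A <= L)%MS.
  apply/sub_kermxP; rewrite /K /controllability_mx mul_mxrow.
  rewrite -(mxrow0 (q_ := fun=> M)); apply/eq_mxrowP => k.
  rewrite -mulmxA (mulmxA A) -[A *m A ^+ _]/(A * A ^+ _) -exprS.
  have [kN|] := ltnP k.+1 N; first exact: LK.
  by rewrite leq_eqVlt ltnS leqNgt ltn_ord orbF => /eqP <-.
suff : L *m x T = 0.
  move=> LxT.
  have /submxP[w wE] : ((x T)^T <= K^T)%MS.
    (* the annihilator of the columns of K is spanned by the rows of L *)
    have /submxP[D CE] : ((cokermx K^T)^T <= L)%MS.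
      by apply/sub_kermxP; rewrite -[K in _ *m K]trmxK -trmx_mul mulmx_coker trmx0.
    by rewrite submxE -[cokermx _]trmxK CE -trmx_mul -mulmxA LxT mulmx0 trmx0.
  by exists w^T; rewrite -[LHS]trmxK wE trmx_mul trmxK.
pose z t := L *m x t.
have zi i : (fun t => z t i 0) = (fun t => \sum_j L i j * x t j 0).
  by apply/funext => t; rewrite mxE.
apply: (@linear_ode_zero R N F T z s) => //.
- move=> i; rewrite zi => t.
  apply: (@cvg_big _ _ +%R 0 xpredT _ _ (nbhs (t : subspace `[0, T])) _ _
    (fun j => L i j * x t j 0)) => [|j _]; first exact: add_continuous.
  by apply: cvgMl_tmp; exact: cx.
- move=> t tT ts i; rewrite zi.
  have [_ dxt] := dx t tT ts.
  have -> : (fun t => \sum_j L i j * x t j 0)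
     = \sum_j (L i j \*: (fun t => x t j 0)).
    by rewrite fct_sumE.
  suff <- : \sum_j L i j *: (A *m x t + B *m u t) j 0 = (F *m z t) i 0.
    by apply: is_derive_sum => j; apply: is_deriveZ.
  have -> : F *m z t = L *m (A *m x t + B *m u t).
    by rewrite /z mulmxDr (mulmxA L A) (mulmxA L B) LB mul0mx addr0 LA mulmxA.
  by rewrite mxE.
- by rewrite /z x0 mulmx0.
Qed.
End Reach.


(** * Independent coordinates on a column space *)

Definition col_span (F : fieldType) (m n : nat) (K : 'M[F]_(m, n))
    (x : 'cV[F]_m) : Prop := exists w, x = K *m w.

Lemma col_span_lin (F : fieldType) (m n : nat) (K : 'M[F]_(m, n)) (a : F)
    (x y : 'cV[F]_m) :
  col_span K x -> col_span K y -> col_span K (a *: x + y).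
Proof.
by move=> [v ->] [w ->]; exists (a *: v + w); rewrite mulmxDr scalemxAr.
Qed.

Lemma col_spanP (F : fieldType) (m n : nat) (K : 'M[F]_(m, n)) (x : 'cV[F]_m) :
  col_span K x <-> (x^T <= K^T)%MS.
Proof.
split=> [[w ->]|/submxP[w wE]]; first by rewrite trmx_mul submxMl.
by exists w^T; rewrite -[LHS]trmxK wE trmx_mul trmxK.
Qed.

Lemma column_basis_span (F : fieldType) (m n r : nat) (K : 'M[F]_(m, n))
    (V : 'M[F]_(m, r)) (x : 'cV[F]_m) :
  column_basis K V -> col_span V x <-> col_span K x.
Proof. by move=> /andP[_ /eqmxP VK]; rewrite !col_spanP VK. Qed.

(** The rows of [K] with index in [C] are independent, expressed by the points
    of the column space rather than by a submatrix because this is what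
    controllability of [C] asks. *)
Definition assignable (F : fieldType) (m n : nat) (K : 'M[F]_(m, n))
    (C : {set 'I_m}) : Prop :=
  forall y : 'I_m -> F, exists2 x, col_span K x & {in C, forall i, x i 0 = y i}.

(** The indices of the canonical vectors that lie in the column space; any
    set of them can be completed to a basis, see [max_canonicalE]. *)
Definition canonical_nodes (F : fieldType) (m n : nat) (K : 'M[F]_(m, n)) :
    {set 'I_m} := [set i | ((delta_mx i 0 : 'cV[F]_m)^T <= K^T)%MS].

Lemma canonical_nodesP (F : fieldType) (m n : nat) (K : 'M[F]_(m, n)) i :
  i \in canonical_nodes K <-> col_span K (delta_mx i 0).
Proof. by rewrite inE col_spanP. Qed.

(** The columns are the vectors dual to the selected coordinates. *)
Lemma reduced_columns (F : fieldType) (m n r : nat) (K : 'M[F]_(m, n))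
    (C : {set 'I_m}) (f : 'I_r -> 'I_m) :
  assignable K C -> injective f -> (forall a, f a \in C) ->
  exists X, rowsub f (K *m X) = 1%:M.
Proof.
move=> KC f_inj fC.
have /choice[w wP] : forall b, exists w : 'cV[F]_n, forall a, (K *m w) (f a) 0 = (a == b)%:R.
  move=> b; have [_ [w ->] xE] := KC (fun i => (i == f b)%:R).
  by exists w => a; rewrite xE// inj_eq.
exists (\matrix_(k, b) w b k 0); apply/matrixP => a b.
rewrite !mxE -wP mxE; by apply: eq_bigr => k _; rewrite mxE.
Qed.

Lemma assignable_card (F : fieldType) (m n : nat) (K : 'M[F]_(m, n))
    (C : {set 'I_m}) : assignable K C -> (#|C| <= \rank K)%N.
Proof.
move=> KC.
have [|X XE] := reduced_columns KC (@enum_val_inj _ (mem C)).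
  exact: enum_valP.
rewrite -[X in (X <= _)%N](mxrank1 F) -XE.
apply: leq_trans (mxrankM_maxl K X); apply: mxrankS.
apply/row_subP => a; rewrite row_rowsub; exact: row_sub.
Qed.

Lemma assignable_sub (F : fieldType) (m n : nat) (K : 'M[F]_(m, n))
    (C D : {set 'I_m}) : D \subset C -> assignable K C -> assignable K D.
Proof.
move=> DC KC y; have [x Kx xE] := KC y; exists x => // i /(fintype.subsetP DC); exact: xE.
Qed.

(** Adding a multiple of [z] adjusts the coordinate [j] without disturbing
    those in [C]. *)
Lemma assignable_add (F : fieldType) (m n : nat) (K : 'M[F]_(m, n))
    (C : {set 'I_m}) (z : 'cV[F]_m) j :
  assignable K C -> col_span K z -> {in C, forall i, z i 0 = 0} -> z j 0 != 0 ->
  assignable K (j |: C).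
Proof.
move=> KC Kz zC zj y; have [x Kx xE] := KC y.
exists ((y j - x j 0) / z j 0 *: z + x); first exact: col_span_lin.
move=> i; rewrite !mxE !inE => /orP[/eqP ->|iC]; first by rewrite divfK// subrK.
by rewrite (zC i iC) mulr0 add0r xE.
Qed.

Lemma assignable_exists (F : fieldType) (m n : nat) (K : 'M[F]_(m, n)) :
  exists2 C : {set 'I_m}, assignable K C & #|C| = \rank K.
Proof.
pose f := maxrankfun K; exists [set f a | a : 'I_(\rank K)]; last first.
  by rewrite card_imset ?card_ord//; exact: maxrankfun_inj.
have /row_freeP[X XE] := maxrowsub_free K.
move=> y; exists (K *m (X *m \col_a y (f a))); first by exists (X *m \col_a y (f a)).
move=> _ /imsetP[a _ ->].
have /matrixP/(_ a 0) : rowsub f (K *m (X *m \col_a y (f a))) = \col_a y (f a).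
  by rewrite -mul_rowsub_mx mulmxA XE mul1mx.
by rewrite !mxE.
Qed.

(** A canonical vector of the column space whose index is outside [C] could
    be used to enlarge [C] beyond the rank. *)
Lemma canonical_sub_assignable (F : fieldType) (m n : nat) (K : 'M[F]_(m, n))
    (C : {set 'I_m}) :
  assignable K C -> #|C| = \rank K -> canonical_nodes K \subset C.
Proof.
move=> KC cC; apply/fintype.subsetP => i /canonical_nodesP Ki; apply: contraT => iC.
have := assignable_card (assignable_add (j := i) KC Ki _ _).
rewrite cardsU1 iC cC ltnn; apply=> [j jC|]; rewrite mxE ?eqxx ?oner_neq0//.
by rewrite andbT; case: eqP => // ji; rewrite -ji jC in iC.
Qed.

(** The vector dual to [i] differs from the canonical vector [i], which is not
    in the space, so it has a nonzero coordinate [j] outside [C]. *)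
Lemma assignable_exchange (F : fieldType) (m n : nat) (K : 'M[F]_(m, n))
    (C : {set 'I_m}) i :
  assignable K C -> i \in C -> i \notin canonical_nodes K ->
  exists j, [/\ j \notin C, assignable K (j |: C :\ i)
              & exists2 z, col_span K z & z j 0 != 0].
Proof.
move=> KC iC iE; have [z Kz zE] := KC (fun k => (k == i)%:R).
have /existsP[j zj] : [exists j, z j 0 != (delta_mx i 0 : 'cV[F]_m) j 0].
  apply: contraR iE; rewrite negb_exists => /forallP zi.
  apply/canonical_nodesP; suff <- : z = delta_mx i 0 by [].
  by apply/colP => j; apply/eqP; rewrite -[_ == _]negbK.
have jC : j \notin C.
  by apply: contra zj => jC; rewrite zE// mxE eqxx andbT.
have {}zj : z j 0 != 0.
  apply: contra zj => /eqP ->; rewrite mxE eqxx andbT.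
  by case: (j =P i) => // ji; rewrite ji iC in jC.
exists j; split=> //; last by exists z.
apply: (assignable_add (z := z)) => //.
  by apply: assignable_sub KC; exact: subsetDl.
by move=> k; rewrite !inE => /andP[/negPf ki kC]; rewrite zE// ki.
Qed.

Lemma reduced_basis (F : fieldType) (m n r : nat) (K : 'M[F]_(m, n))
    (C : {set 'I_m}) (f : 'I_r -> 'I_m) :
  assignable K C -> injective f -> (forall a, f a \in C) -> r = \rank K ->
  exists2 V : 'M[F]_(m, r), column_basis K V & rowsub f V = 1%:M.
Proof.
move=> KC f_inj fC rE; have [X XE] := reduced_columns KC f_inj fC.
exists (K *m X) => //.
have rV : (r <= \rank (K *m X))%N.
  rewrite -[X in (X <= _)%N](mxrank1 F) -XE; apply: mxrankS.
  apply/row_subP => a; rewrite row_rowsub; exact: row_sub.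
have sV : ((K *m X)^T <= K^T)%MS by rewrite trmx_mul submxMl.
rewrite /column_basis /row_free mxrank_tr eqn_leq rank_leq_col rV/=.
by rewrite -(geq_leqif (mxrank_leqif_eq sV)) !mxrank_tr -rE.
Qed.

(** The coordinates of a vector in a reduced basis are its entries on the
    selected rows, so a canonical vector of the space is itself a basis
    vector. *)
Lemma reduced_basis_canonical (F : fieldType) (m n r : nat) (K : 'M[F]_(m, n))
    (f : 'I_r -> 'I_m) (V : 'M[F]_(m, r)) (a : 'I_r) :
  injective f -> column_basis K V -> rowsub f V = 1%:M ->
  f a \in canonical_nodes K -> col a V = delta_mx (f a) 0.
Proof.
move=> f_inj KV fV /canonical_nodesP/(column_basis_span _ KV)[w wE].
suff we : w = delta_mx a 0 by rewrite wE we colE.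
rewrite -[w]mul1mx -fV mul_rowsub_mx -wE.
by apply/colP => b; rewrite !mxE inj_eq.
Qed.

(** The reduced basis on a largest assignable set contains all the canonical
    vectors of the space at once. *)
Lemma max_canonicalE (F : fieldType) (m n : nat) (K : 'M[F]_(m, n)) :
  max_canonical K = #|canonical_nodes K|.
Proof.
apply/eqP; rewrite eqn_leq; apply/andP; split.
  apply/bigmax_leqP => S /asboolP[V [KV SV]]; apply: subset_leq_card.
  apply/fintype.subsetP => i /SV[j Vj]; apply/canonical_nodesP.
  by apply/(column_basis_span _ KV); exists (delta_mx j 0); rewrite -colE.
apply: (@leq_bigmax_cond _ _ (fun S : {set 'I_m} => #|S|)).
apply/asboolP.
have [C KC cC] := assignable_exists K.
have EC := canonical_sub_assignable KC cC.
pose f (a : 'I_(\rank K)) := enum_val (cast_ord (esym cC) a).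
have f_inj : injective f by move=> a b /enum_val_inj/cast_ord_inj.
have [|//|V KV fV] := reduced_basis KC f_inj.
  by move=> a; exact: enum_valP.
exists V; split=> // i iE.
have iC := fintype.subsetP EC i iE.
exists (cast_ord cC (enum_rank_in iC i)).
rewrite (reduced_basis_canonical f_inj KV fV) /f cast_ordK enum_rankK_in//.
Qed.

(** In the basis dual to the coordinates in [C], the rows of [C] form an
    identity matrix, and the columns that are canonical vectors vanish on the
    other rows. *)
Lemma star_form_reduced (F : fieldType) (N n h d p : nat) (K : 'M[F]_(N, n))
    (C : {set 'I_N}) (sigma : 'I_(h + d + p) -> 'I_N) :
  (h + d)%N = \rank K -> assignable K C -> bijective sigma ->
  (forall a, sigma (lshift p a) \in C) ->
  (forall a, sigma (Defs.row1 d p a) \in canonical_nodes K) ->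
  exists R32, star_form K sigma 1%:M R32.
Proof.
move=> hd KC s_bij sC sE.
have s_inj : injective (fun a => sigma (lshift p a)).
  by move=> a b /(bij_inj s_bij)/lshift_inj.
have [V KV fV] := reduced_basis KC s_inj sC hd.
exists (rsubmx (rowsub (fun a => sigma (Defs.row3 h d a)) V)).
split=> //; first exact: unitmx1.
exists V => //; rewrite /star_mx -scalar_mx_block -fV -[LHS]vsubmxK.
congr col_mx; first by apply/matrixP => i j; rewrite !mxE.
rewrite -[LHS]hsubmxK; congr row_mx; last by apply/matrixP => i j; rewrite !mxE.
apply/matrixP => i j; rewrite !mxE.
have /colP/(_ (sigma (Defs.row3 h d i))) := reduced_basis_canonical s_inj KV fV (sE j).
by rewrite !mxE inj_eq ?eq_rlshift//; exact: bij_inj.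
Qed.

(** The column space is a graph over the coordinates of the first two blocks;
    those of the first block do not enter its equation because of the zero
    block of the form. *)
Lemma star_form_span (F : fieldType) (N n h d p : nat) (K : 'M[F]_(N, n))
    (sigma : 'I_(h + d + p) -> 'I_N) (R22 : 'M[F]_d) (R32 : 'M[F]_(p, d))
    (x : 'cV[F]_N) :
  star_form K sigma R22 R32 ->
  col_span K x <-> state3 sigma x = R32 *m invmx R22 *m state2 sigma x.
Proof.
move=> [s_bij uR [V KV sV]].
rewrite -(column_basis_span _ KV).
have sVE (w1 : 'cV[F]_h) (w2 : 'cV[F]_d) : rowsub sigma (V *m col_mx w1 w2)
    = col_mx (col_mx w1 (R22 *m w2)) (R32 *m w2).
  rewrite -mul_rowsub_mx sV /star_mx mul_col_mx mul_block_col mul_row_col.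
  by rewrite mul1mx !mul0mx addr0 !add0r.
have s2 y1 y2 (y3 : 'cV[F]_p) : rowsub sigma x = col_mx (col_mx y1 y2) y3 ->
   state2 sigma x = y2 /\ state3 sigma x = y3.
  move=> E; split.
    have -> : state2 sigma x = dsubmx (usubmx (rowsub sigma x)).
      by apply/matrixP => i j; rewrite !mxE.
    by rewrite E col_mxKu col_mxKd.
  have -> : state3 sigma x = dsubmx (rowsub sigma x).
    by apply/matrixP => i j; rewrite !mxE.
  by rewrite E col_mxKd.
split=> [[w xw]|x3].
  have := sVE (usubmx w) (dsubmx w); rewrite vsubmxK -xw => /s2[-> ->].
  by rewrite mulmxA mulmxKV.
exists (col_mx (usubmx (usubmx (rowsub sigma x))) (invmx R22 *m state2 sigma x)).
have [t sK tK] := s_bij.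
suff E : rowsub sigma x = rowsub sigma (V *m col_mx (usubmx (usubmx (rowsub sigma x)))
   (invmx R22 *m state2 sigma x)).
  apply/colP => i; move/colP/(_ (t i)): E.
  by rewrite !(mxE, tK).
rewrite sVE mulmxA mulmxV// mul1mx mulmxA -x3.
rewrite -[LHS]vsubmxK -[usubmx (rowsub sigma x) in LHS]vsubmxK.
congr (col_mx (col_mx _ _) _); by apply/matrixP => i j; rewrite !mxE.
Qed.

Lemma row_cases (h d p : nat) (a : 'I_(h + d + p)) :
  [\/ exists b, a = Defs.row1 d p b, exists b, a = Defs.row2 h p b | exists b, a = Defs.row3 h d b].
Proof.
case: (split_ordP a) => [b ->|b ->]; last by constructor 3; exists b.
case: (split_ordP b) => [c ->|c ->]; first by constructor 1; exists c.
by constructor 2; exists c.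
Qed.

(** The nodes are listed as [E], then [C] minus [E], then the others. *)
Lemma row_bij_exists (N h d p : nat) (E C : {set 'I_N}) :
  E \subset C -> #|E| = h -> #|C| = (h + d)%N -> #|~: C| = p ->
  exists sigma : 'I_(h + d + p) -> 'I_N,
    [/\ bijective sigma, nodes1 sigma = E & nodes2 sigma = C :\: E].
Proof.
move=> EC <- cC <-.
have cD : #|C :\: E| = d by rewrite cardsD (finset.setIidPr EC) cC addKn.
rewrite -{}cD {cC}.
pose sigma (a : 'I_(#|E| + #|C :\: E| + #|~: C|)) : 'I_N :=
  match fintype.split a with
  | inl b => match fintype.split b with
             | inl c => enum_val c | inr c => enum_val c end
  | inr b => enum_val b end.
have s1 a : sigma (Defs.row1 _ _ a) = enum_val a.
  by rewrite /sigma /Defs.row1 !(unsplitK (inl _)).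
have s2 a : sigma (Defs.row2 _ _ a) = enum_val a.
  by rewrite /sigma /Defs.row2 (unsplitK (inl _)) (unsplitK (inr _)).
have s3 a : sigma (Defs.row3 _ _ a) = enum_val a.
  by rewrite /sigma /Defs.row3 (unsplitK (inr _)).
exists sigma.
have s_inj : injective sigma.
  have dE (a : 'I_#|E|) (b : 'I_#|C :\: E|) : enum_val a <> enum_val b.
    by move=> ab; have := enum_valP b; rewrite -ab inE enum_valP.
  have dC (a : 'I_N) (b : 'I_#|~: C|) : a \in C -> a <> enum_val b.
    by move=> aC ab; have := enum_valP b; rewrite -ab inE aC.
  have E_C (a : 'I_#|E|) : enum_val a \in C.
    exact: (fintype.subsetP EC) (enum_valP a).
  have D_C (a : 'I_#|C :\: E|) : enum_val a \in C.
    by have := enum_valP a; rewrite inE => /andP[].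
  move=> a b; case: (row_cases a) => [] [a' ->]; case: (row_cases b) => [] [b' ->];
    rewrite ?s1 ?s2 ?s3.
  - by move=> /enum_val_inj ->.
  - by move=> /dE.
  - by move=> /(dC _ _ (E_C _)).
  - by move=> /esym/dE.
  - by move=> /enum_val_inj ->.
  - by move=> /(dC _ _ (D_C _)).
  - by move=> /esym/(dC _ _ (E_C _)).
  - by move=> /esym/(dC _ _ (D_C _)).
  - by move=> /enum_val_inj ->.
split.
- apply: (inj_card_bij s_inj); rewrite !card_ord cardsD (finset.setIidPr EC).
  by rewrite subnKC ?subset_leq_card// cardsC card_ord.
- apply/setP => i; apply/imsetP/idP => [[a _ ->]|iE]; first by rewrite s1 enum_valP.
  by exists (enum_rank_in iE i); rewrite ?s1 ?enum_rankK_in.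
- apply/setP => i; apply/imsetP/idP => [[a _ ->]|iE]; first by rewrite s2 enum_valP.
  by exists (enum_rank_in iE i); rewrite ?s2 ?enum_rankK_in.
Qed.


(** * Controllable and perturbed nodes *)

Section Generic.
Local Open Scope classical_set_scope.
Local Open Scope ring_scope.

(** Near a zero w of a nonzero linear form, the form is nonzero at w + t v0
    for small t <> 0, where v0 is any point at which it does not vanish. *)
Lemma generically_row_neq0 (R : realType) (m n : nat) (G : 'M[R]_(m, n)) (a : 'I_m) :
  generically (fun v : 'cV[R]_n => (G *m v) a 0 != 0) <->
  exists v : 'cV[R]_n, (G *m v) a 0 != 0.
Proof.
split=> [[U [_ dU UP]]|[v0 Gv0]].
  have [||v [_ /UP Gv]] := dU setT; [by exists 0|exact: openT|by exists v].
have cG : continuous (fun v : 'cV[R]_n => (G *m v) a 0).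
  have -> : (fun v : 'cV[R]_n => (G *m v) a 0) = (fun v => \sum_j G a j * v j 0).
    by apply/funext => v; rewrite mxE.
  apply: continuous_big => [|j _ v]; first exact: add_continuous.
  apply: (@cvgMl_tmp _ _ (nbhs v)); exact: coord_continuous.
exists [set v | (G *m v) a 0 != 0]; split=> //.
  apply: (@open_comp _ _ (fun v : 'cV[R]_n => (G *m v) a 0) [set r | r != 0]).
    by move=> v _; exact: cG.
  exact: open_neq.
move=> O [w Ow] oO.
have [Gw|Gw] := eqVneq ((G *m w) a 0) 0; last by exists w.
have cl : continuous (fun t : R => w + t *: v0).
  move=> t; apply: cvgD; first exact: cvg_cst.
  by apply: cvgZr_tmp; exact: cvg_id.
have : \forall t \near (0 : R)^', O (w + t *: v0).
  apply: nbhs_dnbhs; apply: (cl 0); rewrite scale0r addr0.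
  exact: open_nbhs_nbhs.
move=> Ot; have {}Ot : \forall t \near (0 : R)^', O (w + t *: v0) /\ t != 0.
  by near=> t; split; [near: t|near: t; exact: nbhs_dnbhs_neq].
have [t [Owt t0]] := filter_ex Ot.
exists (w + t *: v0); split=> //=.
by rewrite mulmxDr -scalemxAr mxE Gw add0r mxE mulf_neq0.
Unshelve. all: by end_near. Qed.

End Generic.

(** Starting from 0 shows that the condition is necessary.  For another initial
    state, the free motion is corrected by a point of the column space. *)
Lemma simultaneously_controllableP (R : realType) (N M : nat) (A : 'M[R]_N)
    (B : 'M[R]_(N, M)) (S : {set 'I_N}) :
  simultaneously_controllable A B S <-> assignable (controllability_mx A B) S.
Proof.
split=> [SC y|KS x0 y].
  by have [x [/reachable_span Kx xE]] := SC 0 y; exists x.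
have [x1 m1] := free_motion A B x0.
have [_ [w ->] xE] := KS (fun i => y i - x1 i 0).
exists (controllability_mx A B *m w + x1); split.
  have := moves_lin 1 (moves_span A B w) m1.
  by rewrite !scale1r add0r => /moves_steers.
by move=> i /xE; rewrite !mxE => ->; rewrite subrK.
Qed.

Lemma controllable_nodesP (R : realType) (N M : nat) (A : 'M[R]_N)
    (B : 'M[R]_(N, M)) (C : {set 'I_N}) :
  controllable_nodes A B C <->
  assignable (controllability_mx A B) C /\ #|C| = \rank (controllability_mx A B).
Proof.
split=> [[/simultaneously_controllableP KC Cmax]|[KC cC]].
  split=> //; apply/eqP; rewrite eqn_leq assignable_card//=.
  have [D KD <-] := assignable_exists (controllability_mx A B).
  by apply: Cmax; apply/simultaneously_controllableP.
split; first exact/simultaneously_controllableP.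
by move=> S /simultaneously_controllableP/assignable_card; rewrite cC.
Qed.

Section StarForm.
Variables (R : realType) (N n h d p : nat) (K : 'M[R]_(N, n)).
Variables (sigma : 'I_(h + d + p) -> 'I_N) (R22 : 'M[R]_d) (R32 : 'M[R]_(p, d)).
Hypothesis star : star_form K sigma R22 R32.

Let sigma_bij : bijective sigma. Proof. by case: star. Qed.
Let sigma_inj : injective sigma. Proof. exact: bij_inj. Qed.

Lemma card_nodes1 : #|nodes1 sigma| = h.
Proof.
by rewrite card_imset ?card_ord// => a b /sigma_inj/lshift_inj/lshift_inj.
Qed.

Lemma card_nodes2 : #|nodes2 sigma| = d.
Proof.
by rewrite card_imset ?card_ord// => a b /sigma_inj/lshift_inj/rshift_inj.
Qed.

Lemma nodes_disjoint : [disjoint nodes1 sigma & nodes2 sigma].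
Proof.
rewrite disjoint_subset; apply/fintype.subsetP => _ /imsetP[a _ ->].
rewrite inE; apply/imsetP => -[b _ /sigma_inj/lshift_inj/eqP].
by rewrite eq_lrshift.
Qed.

Lemma outside_nodes j :
  j \notin nodes1 sigma :|: nodes2 sigma <-> exists a, j = sigma (Defs.row3 h d a).
Proof.
split=> [jC|[a ->]].
  have [t sK tK] := sigma_bij; rewrite -(tK j) in jC *.
  case: (row_cases (t j)) => [] [a tE]; rewrite tE in jC *; last by exists a.
  - by rewrite inE imset_f in jC.
  - by rewrite inE [X in _ || X]imset_f ?orbT in jC.
by rewrite inE negb_or; apply/andP; split; apply/imsetP => -[b _ /sigma_inj/eqP];
  rewrite eq_rlshift.
Qed.

Lemma star_form_assign (y1 : 'cV[R]_h) (y2 : 'cV[R]_d) :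
  exists x, [/\ col_span K x, (forall a, x (sigma (Defs.row1 d p a)) 0 = y1 a 0)
              & state2 sigma x = y2].
Proof.
have [t sK tK] := sigma_bij.
(* the third block is the one that the equation of the space imposes *)
exists (rowsub t (col_mx (col_mx y1 y2) (R32 *m invmx R22 *m y2))).
have s2 : state2 sigma (rowsub t (col_mx (col_mx y1 y2) (R32 *m invmx R22 *m y2))) = y2.
  by apply/colP => a; rewrite !mxE sK /Defs.row2 !(unsplitK (inl _)) !mxE (unsplitK (inr _)).
split=> //; last first.
  by move=> a; rewrite !mxE sK !(unsplitK (inl _)) !mxE (unsplitK (inl _)).
apply/(star_form_span _ star); rewrite s2.
by apply/colP => a; rewrite mxE mxE sK col_mxEd.
Qed.

Lemma star_form_assignable : assignable K (nodes1 sigma :|: nodes2 sigma).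
Proof.
move=> y.
have [x [Kx x1 x2]] := star_form_assign (\col_a y (sigma (Defs.row1 d p a)))
  (\col_a y (sigma (Defs.row2 h p a))).
exists x => // i; rewrite inE => /orP[] /imsetP[a _ ->].
  by rewrite x1 mxE.
by have /colP/(_ a) := x2; rewrite !mxE.
Qed.

(** A canonical vector with index in the first block has zero coordinates in
    the other two, so it satisfies the equation of the column space. *)
Lemma nodes1_canonical : nodes1 sigma \subset canonical_nodes K.
Proof.
apply/fintype.subsetP => _ /imsetP[a _ ->]; apply/canonical_nodesP.
apply/(star_form_span _ star).
have -> : state2 sigma (delta_mx (sigma (Defs.row1 d p a)) 0 : 'cV[R]_N) = 0.
  apply/colP => b; rewrite !mxE (inj_eq sigma_inj) andbT.
  by rewrite /Defs.row1 /Defs.row2 (inj_eq (@lshift_inj _ _)) eq_rlshift.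
rewrite mulmx0; apply/colP => b; rewrite !mxE (inj_eq sigma_inj) andbT.
by rewrite /Defs.row1 /Defs.row3 eq_rlshift.
Qed.

Lemma nodes3_nonzeroP j :
  j \in nodes3_nonzero sigma R22 R32 <->
  j \notin nodes1 sigma :|: nodes2 sigma /\
  exists2 x, col_span K x & x j 0 != 0.
Proof.
have s3 (x : 'cV[R]_N) a : x (sigma (Defs.row3 h d a)) 0 = state3 sigma x a 0.
  by rewrite mxE.
split=> [/imsetP[a + ->]|[/outside_nodes[a ->] [x Kx xj]]].
  rewrite inE => /asboolP/generically_row_neq0[v Gv].
  split; first by apply/outside_nodes; exists a.
  have [x [Kx _ x2]] := star_form_assign 0 v; exists x => //.
  by move/(star_form_span _ star): Kx; rewrite s3 x2 => ->.
apply/imset_f; rewrite inE; apply/asboolP/generically_row_neq0.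
exists (state2 sigma x); rewrite s3 in xj.
by move/(star_form_span _ star): Kx => <-.
Qed.

Lemma star_form_determined x y j :
  col_span K x -> col_span K y ->
  {in nodes1 sigma :|: nodes2 sigma, forall i, x i 0 = y i 0} -> x j 0 = y j 0.
Proof.
move=> /(star_form_span _ star) x3 /(star_form_span _ star) y3 xy.
have [/xy//|/outside_nodes[a ->]] := boolP (j \in nodes1 sigma :|: nodes2 sigma).
have xy2 : state2 sigma x = state2 sigma y.
  by apply/colP => b; rewrite !mxE xy// inE [X in _ || X]imset_f ?orbT.
have : state3 sigma x = state3 sigma y by rewrite x3 y3 xy2.
by move/colP/(_ a); rewrite !mxE.
Qed.

End StarForm.

(** Every largest assignable set [C] underlies a block form, with the identity
    as its square block. *)
Lemma star_form_exists (F : fieldType) (N n h d p : nat) (K : 'M[F]_(N, n))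
    (C : {set 'I_N}) :
  h = max_canonical K -> d = (\rank K - h)%N -> p = (N - \rank K)%N ->
  assignable K C -> #|C| = \rank K ->
  exists (sigma : 'I_(h + d + p) -> 'I_N) R32,
    [/\ star_form K sigma 1%:M R32, nodes2 sigma = C :\: canonical_nodes K
      & nodes1 sigma :|: nodes2 sigma = C].
Proof.
rewrite max_canonicalE => hE dE pE KC cC.
have EC := canonical_sub_assignable KC cC.
have hd : (h + d)%N = \rank K.
  by rewrite dE subnKC// hE -cC subset_leq_card.
have [|||sigma [s_bij s1 s2]] := @row_bij_exists N h d p _ _ EC.
- by [].
- by rewrite cC hd.
- by rewrite pE -cC -[X in (X - _)%N](card_ord N) -(cardsC C) addKn.
have [||R32 star] := star_form_reduced hd KC s_bij.
- move=> a; case: (split_ordP a) => b ->.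
    by apply: (fintype.subsetP EC); rewrite -s1 imset_f.
  suff : sigma (Defs.row2 h p b) \in C :\: canonical_nodes K.
    by rewrite inE => /andP[].
  by rewrite -s2 imset_f.
- by move=> a; rewrite -s1 imset_f.
exists sigma, R32; split=> //.
by rewrite s1 s2 -{1}(finset.setIidPr EC) finset.setID.
Qed.

Theorem proposition2 (R : realType) (N M : nat)
    (A : 'M[R]_N) (B : 'M[R]_(N, M))
    (HB : forall k : 'I_M, exists! i : 'I_N, B i k != 0)
    (h d p : nat)
    (Hh : h = max_canonical (controllability_mx A B))
    (Hd : d = (\rank (controllability_mx A B) - h)%N)
    (Hp : p = (N - \rank (controllability_mx A B))%N) :
  let K := controllability_mx A B in
  [/\ (* the form exists *)
      exists (sigma : 'I_(h + d + p) -> 'I_N) (R22 : 'M[R]_d)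
             (R32 : 'M[R]_(p, d)), star_form K sigma R22 R32,
      (* every choice of the form yields a set of controllable nodes, its
         perturbed nodes, and the relation on the reachable points *)
      forall (sigma : 'I_(h + d + p) -> 'I_N) (R22 : 'M[R]_d)
             (R32 : 'M[R]_(p, d)), star_form K sigma R22 R32 ->
        [/\ #|nodes1 sigma| = h,
            #|nodes2 sigma| = (\rank K - h)%N,
            controllable_nodes A B (nodes1 sigma :|: nodes2 sigma),
            (forall xbar : 'cV[R]_N, reachable A B xbar ->
               state3 sigma xbar
                 = R32 *m invmx R22 *m state2 sigma xbar)
          & (forall j : 'I_N,
               perturbed A B (nodes1 sigma :|: nodes2 sigma) j
               <-> j \in nodes3_nonzero sigma R22 R32)],
      (* every set of controllable nodes arises in this way *)
      forall C : {set 'I_N}, controllable_nodes A B C ->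
        exists (sigma : 'I_(h + d + p) -> 'I_N) (R22 : 'M[R]_d)
               (R32 : 'M[R]_(p, d)),
          star_form K sigma R22 R32 /\ C = nodes1 sigma :|: nodes2 sigma,
      (* C^1 is unique *)
      forall (sigma sigma' : 'I_(h + d + p) -> 'I_N) (R22 R22' : 'M[R]_d)
             (R32 R32' : 'M[R]_(p, d)),
        star_form K sigma R22 R32 -> star_form K sigma' R22' R32' ->
        nodes1 sigma = nodes1 sigma'
    & (* C^2 and P are not unique, unless R22 is an empty block *)
      (h < \rank K)%N ->
      exists (sigma sigma' : 'I_(h + d + p) -> 'I_N) (R22 R22' : 'M[R]_d)
             (R32 R32' : 'M[R]_(p, d)),
        [/\ star_form K sigma R22 R32, star_form K sigma' R22' R32',
            nodes2 sigma <> nodes2 sigma'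
          & nodes3_nonzero sigma R22 R32 <> nodes3_nonzero sigma' R22' R32']].

Proof.
move=> K; rewrite -/K in Hh Hd Hp.
have Hr : (h <= \rank K)%N.
  have [C KC cC] := assignable_exists K.
  rewrite Hh max_canonicalE -cC subset_leq_card//.
  exact: canonical_sub_assignable.
have starC C := star_form_exists Hh Hd Hp (C := C).
have n1E (sigma : 'I_(h + d + p) -> 'I_N) R22 R32 : star_form K sigma R22 R32 ->
    nodes1 sigma = canonical_nodes K.
  move=> star; apply/eqP; rewrite eqEcard (nodes1_canonical star).
  by rewrite (card_nodes1 star) Hh max_canonicalE/=.
split.
- have [C KC cC] := assignable_exists K.
  by have [s [R32 [star _ _]]] := starC C KC cC; exists s, 1%:M, R32.
- move=> s R22 R32 star; split.
  + exact: card_nodes1 star.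
  + by rewrite (card_nodes2 star).
  + apply/controllable_nodesP; split; first exact: star_form_assignable star.
    have := nodes_disjoint star; rewrite -setI_eq0 cardsU => /eqP ->.
    by rewrite cards0 subn0 (card_nodes1 star) (card_nodes2 star) Hd subnKC.
  + by move=> x /reachable_span Kx; apply/(star_form_span _ star).
  + move=> j; rewrite (nodes3_nonzeroP star); split=> [[jC _ [x]]|[jC [x Kx xj]]].
      by move=> /reachable_span Kx xj; split=> //; exists x.
    split=> //; last by exists x => //; apply/reachable_span.
    by move=> y z /reachable_span Ky /reachable_span Kz; exact: (star_form_determined star).
- move=> C /controllable_nodesP[KC cC].
  by have [s [R32 [star _ sC]]] := starC C KC cC; exists s, 1%:M, R32.
- by move=> s s' R22 R22' R32 R32' /n1E -> /n1E ->.
- move=> hr; have [C KC cC] := assignable_exists K.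
  have [i iC iE] : exists2 i, i \in C & i \notin canonical_nodes K.
    apply/subsetPn; apply: contraL hr => /subset_leq_card.
    by rewrite cC Hh max_canonicalE -leqNgt.
  have [j [jC KC' [z Kz zj]]] := assignable_exchange KC iC iE.
  have cC' : #|j |: C :\ i| = \rank K.
    rewrite cardsU1 !inE (negPf jC) andbF -cC (cardsD1 i C) iC.
    by rewrite add1n.
  have [s [R32 [star s2 sC]]] := starC C KC cC.
  have [s' [R32' [star' s2' sC']]] := starC _ KC' cC'.
  exists s, s', 1%:M, 1%:M, R32, R32'; split=> //.
    rewrite s2 s2' => /setP/(_ i); rewrite !finset.in_setD in_setU1 in_setD1 iC iE eqxx/= orbF.
    move=> /esym/eqP ij.
    by rewrite -ij iC in jC.
  move=> /setP/(_ j).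
  have -> : j \in nodes3_nonzero s 1%:M R32.
    by apply/(nodes3_nonzeroP star); rewrite sC; split=> //; exists z.
  by move=> /esym/(nodes3_nonzeroP star')[]; rewrite sC' !inE eqxx.
Qed.
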